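(* Let $n \ge 2$ be an integer. (1) If the prime power $q$ is sufficiently large (with $n$ fixed), then every $\mathbb{F}_q$-linear code $\mathcal{C} \le \mathbb{F}_q^n$ that is maximal with respect to the Hamming metric is MDS. Equivalently, if $\mathcal{F}$ is the family of $\mathbb{F}_q$-linear maximal codes in $\mathbb{F}_q^n$ and $\mathcal{F}'$ is the family of MDS codes in $\mathbb{F}_q^n$, then $|\mathcal{F}'|/|\mathcal{F}|=1$ for $q$ sufficiently large. (2) Let $q$ be a prime power. If the integer $m\ge n$ is sufficiently large (with $n,q$ fixed), then every $\mathbb{F}_{q^m}$-linear code $\mathcal{C} \le \mathbb{F}_{q^m}^n$ that is maximal with respect to the rank metric is MRD. Equivalently, if $\mathcal{F}$ is the family of $\mathbb{F}_{q^m}$-linear maximal codes in $\mathbb{F}_{q^m}^n$ and $\mathcal{F}'$ is the family of MRD codes in $\mathbb{F}_{q^m}^n$, then $|\mathcal{F}'|/|\mathcal{F}|=1$ for $m$ sufficiently large.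
   Context: The rank weight of $x \in \mathbb{F}_{q^m}^n$ is the $\mathbb{F}_q$-dimension of the $\mathbb{F}_q$-span of its components, and the rank distance between $x,y\in \mathbb{F}_{q^m}^n$ is the rank weight of $x-y$. The minimum distance $d(\mathcal{C})$ of a non-zero linear code is the minimum distance between distinct codewords (in the metric under consideration). A linear code $\mathcal{C}$ in an ambient space $X$ (here $X=\mathbb{F}_q^n$ over $\mathbb{F}_q$ with the Hamming metric, or $X=\mathbb{F}_{q^m}^n$ over $\mathbb{F}_{q^m}$ with the rank metric) is maximal if $\mathcal{C}\neq\{0\}$ and there is no linear code $\mathcal{C}'\le X$ with $\mathcal{C}'\ge\mathcal{C}$, $\dim(\mathcal{C}')=\dim(\mathcal{C})+1$ and $d(\mathcal{C}')=d(\mathcal{C})$. A $k$-dimensional $\mathbb{F}_q$-linear code in $\mathbb{F}_q^n$ with $k \ge 1$ is MDS if its minimum Hamming distance is $n-k+1$. A $k$-dimensional $\mathbb{F}_{q^m}$-linear code in $\mathbb{F}_{q^m}^n$ with $k\ge 1$ is MRD if its minimum rank distance is $n-k+1$. *)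

(* Defs.v *)
From HB Require Import structures.
From mathcomp Require Import all_boot all_order all_algebra all_field.

Set Implicit Arguments.
Unset Strict Implicit.
Unset Printing Implicit Defensive.

Import GRing.Theory VectorInternalTheory.
Local Open Scope ring_scope.

(* Subspaces are encoded by canonical matrices, hence form a finite type over a
   finite field; this allows counting and quantifying over codes. *)
HB.instance Definition _ (K : finFieldType) (vT : vectType K) :=
  [Countable of {vspace vT} by <:].
HB.instance Definition _ (K : finFieldType) (vT : vectType K) :=
  [Finite of {vspace vT} by <:].

Definition hamming_dist (K : finFieldType) (n : nat) (x y : 'rV[K]_n) : nat :=
  #|[set i | x 0 i != y 0 i]|.

Definition rank_weight (F : fieldType) (L : fieldExtType F) (n : nat)
    (x : 'rV[L]_n) : nat :=
  \dim <<[seq x 0%R i | i <- enum 'I_n]>>%VS.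

Definition rank_dist (F : fieldType) (L : fieldExtType F) (n : nat)
    (x y : 'rV[L]_n) : nat :=
  rank_weight (x - y).

(* [vpick C] is a nonzero element of C when C != 0, so (0, vpick C) is a pair of
   distinct codewords and the arg min is a genuine minimum. The value is
   meaningless for C = 0. *)
Definition min_dist (K : finFieldType) (n : nat)
    (dist : 'rV[K]_n -> 'rV[K]_n -> nat) (C : {vspace 'rV[K]_n}) : nat :=
  let p := [arg min_(p < (0, vpick C) |
              [&& p.1 \in C, p.2 \in C & p.1 != p.2]) dist p.1 p.2] in
  dist p.1 p.2.

Definition is_maximal (K : finFieldType) (n : nat)
    (dist : 'rV[K]_n -> 'rV[K]_n -> nat) (C : {vspace 'rV[K]_n}) : bool :=
  (C != 0%VS) &&
  ~~ [exists C' : {vspace 'rV[K]_n},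
       [&& (C <= C')%VS, \dim C' == (\dim C + 1)%N
         & min_dist dist C' == min_dist dist C]].

Definition is_MDS (K : finFieldType) (n : nat) (C : {vspace 'rV[K]_n}) : bool :=
  (1 <= \dim C)%N &&
  (min_dist (@hamming_dist K n) C == (n - \dim C + 1)%N).

(* [finvect_type L] is L itself, equipped with its finite field structure in
   addition to that of an extension of F. *)
Definition is_MRD (F : finFieldType) (L : fieldExtType F) (n : nat)
    (C : {vspace 'rV[finvect_type L]_n}) : bool :=
  (1 <= \dim C)%N &&
  (min_dist (@rank_dist F (finvect_type L) n) C == (n - \dim C + 1)%N).

(* Main.v *)
(* If C is maximal with minimum distance d, the balls of radius d - 1 around the
   codewords cover K^n, so |K|^n <= |K|^(dim C) |B(d-1)|. Every word of weight at
   most r factors as A M, with A a row of length r over K and M an r x n matrix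
   over a finite set T independent of the size of K (T = {0, 1} for the Hamming
   metric, T = F_q for the rank metric). Hence |B(r)| <= |K|^r |T|^(r n), and
   d <= n - dim C is impossible as soon as |K| > |T|^(n^2). Conversely, a code
   meeting the Singleton bound has no larger code with the same distance. *)

Require Import Defs.
From mathcomp Require Import all_boot all_order all_algebra all_field.

Set Implicit Arguments.
Unset Strict Implicit.
Unset Printing Implicit Defensive.

Import GRing.Theory.
Local Open Scope ring_scope.

(** * Codes for a translation-invariant distance bounded by the Hamming distance *)

Section TranslationInvariantDistance.

Variables (K : finFieldType) (n : nat) (dist : 'rV[K]_n -> 'rV[K]_n -> nat).
Hypothesis distB : forall x y, dist x y = dist (x - y) 0.

Lemma min_dist_attained (C : {vspace 'rV[K]_n}) : C != 0%VS ->
  exists2 x, x \in C & x != 0 /\ dist x 0 = min_dist dist C.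
Proof.
move=> C0; rewrite /min_dist; case: arg_minnP => /=.
  by rewrite mem0v memv_pick eq_sym vpick0.
case=> x y /= /and3P[xC yC xy] _; exists (x - y); first by rewrite rpredB.
by rewrite subr_eq0 xy -distB.
Qed.

Lemma min_dist_le (C : {vspace 'rV[K]_n}) x :
  x \in C -> x != 0 -> (min_dist dist C <= dist x 0)%N.
Proof.
move=> xC x0; rewrite /min_dist; case: arg_minnP => /=.
  rewrite mem0v memv_pick eq_sym vpick0; apply: contraNneq x0 => C0.
  by rewrite -memv0 -C0.
by case=> y z _ /(_ (x, 0)); apply; rewrite /= xC mem0v x0.
Qed.

Lemma min_dist_antimono (C D : {vspace 'rV[K]_n}) :
  C != 0%VS -> (C <= D)%VS -> (min_dist dist D <= min_dist dist C)%N.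
Proof.
move=> /min_dist_attained[x xC [x0 <-]] /subvP CD.
by apply: min_dist_le => //; apply: CD.
Qed.

Hypothesis dist_gt0 : forall x, x != 0 -> (0 < dist x 0)%N.
Hypothesis dist_hamming : forall x, (dist x 0 <= hamming_dist x 0)%N.

Lemma min_dist_gt0 (C : {vspace 'rV[K]_n}) :
  C != 0%VS -> (0 < min_dist dist C)%N.
Proof. by move=> /min_dist_attained[x _ [x0 <-]]; apply: dist_gt0. Qed.

Lemma dim_rV (C : {vspace 'rV[K]_n}) : (\dim C <= n)%N.
Proof. by rewrite (leq_trans (dimvS (subvf C))) // dimvf /dim /= mul1n. Qed.

(* Some nonzero codeword vanishes on the first [\dim C - 1] coordinates. *)
Lemma singleton_bound (C : {vspace 'rV[K]_n}) :
  C != 0%VS -> (min_dist dist C <= n - \dim C + 1)%N.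
Proof.
rewrite -dimv_eq0 -lt0n => C0; set k := \dim C in C0 *.
have kn : (k <= n)%N := dim_rV C.
(* Multiplication by [P] keeps the first [k.-1] coordinates. The image of [C] has dimension less
   than [k], so rank-nullity gives a nonzero codeword in the kernel. *)
pose P : 'M[K]_(n, k.-1) := \matrix_(i, j) (i == j :> nat)%:R.
pose phi := linfun (mulmxr P : 'rV[K]_n -> 'rV[K]_k.-1).
have dI : (0 < \dim (C :&: lker phi))%N.
  have := limg_ker_dim phi C.
  have := dimvS (subvf (phi @: C)); rewrite dimvf /dim /= mul1n -/k.
  by move=> le1 e; rewrite -(ltn_add2r (\dim (phi @: C))) e add0n
    (leq_ltn_trans le1) // prednK.
have [x xI x0] : exists2 x, x \in (C :&: lker phi)%VS & x != 0.
  exists (vpick (C :&: lker phi)); first exact: memv_pick.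
  by rewrite vpick0 -dimv_eq0 -lt0n.
move: xI; rewrite memv_cap memv_ker => /andP[xC].
rewrite lfunE /= => /eqP/rowP xP.
have x_lt (i : 'I_n) : (i < k.-1)%N -> x 0 i = 0.
  move=> ik; have := xP (Ordinal ik); rewrite !mxE (bigD1 i) //= big1 ?addr0.
    by rewrite mxE eqxx mulr1.
  by move=> j ji; rewrite mxE /= (_ : (j == i :> nat) = false) ?mulr0 //;
    apply: negbTE.
apply: leq_trans (min_dist_le xC x0) (leq_trans (dist_hamming x) _).
rewrite /hamming_dist.
have widen_inj : injective (widen_ord (leq_trans (leq_pred k) kn)).
  by move=> i j /(congr1 val) /= ij; apply: val_inj.
have sub : [set i | x 0 i != (0 : 'rV_n) 0 i] \subset
    ~: [set widen_ord (leq_trans (leq_pred k) kn) i | i : 'I_k.-1].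
  apply/subsetP=> i; rewrite !inE mxE; apply: contra => /imsetP[j _ ->].
  by apply/eqP/x_lt => /=.
apply: leq_trans (subset_leq_card sub) _.
rewrite cardsCs setCK card_imset // !card_ord.
by rewrite addn1 -subSn // -{2}(prednK C0) subSS.
Qed.

Variables (T : finType) (f : T -> K).
Hypothesis distZ : forall a x, (dist (a *: x) 0 <= dist x 0)%N.
Hypothesis dist_factor : forall r x, (dist x 0 <= r)%N ->
  exists A : 'rV[K]_r, exists M : 'M[T]_(r, n), x = A *m map_mx f M.

Lemma card_ball r :
  (#|[set x | (dist x 0 <= r)%N]| <= #|K| ^ r * #|T| ^ (r * n))%N.
Proof.
pose g (p : 'rV[K]_r * 'M[T]_(r, n)) := p.1 *m map_mx f p.2.
have sub : [set x | (dist x 0 <= r)%N] \subset [set g p | p : _].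
  apply/subsetP=> x; rewrite inE => /dist_factor[A [M ->]].
  by apply/imsetP; exists (A, M).
apply: leq_trans (subset_leq_card sub) (leq_trans (leq_imset_card _ _) _).
by rewrite card_prod !card_mx mul1n.
Qed.

(* A word outside [C + ball] could be added to [C] without creating codewords of
   small weight. *)
Lemma maximal_covering (C : {vspace 'rV[K]_n}) v : is_maximal dist C ->
  exists2 c, c \in C & (dist (v - c) 0 < min_dist dist C)%N.
Proof.
case/andP=> C0 /existsPn maxC.
have [vC|vC] := boolP (v \in C).
  (* No axiom says that [dist 0 0] is 0; this comes from the Hamming bound. *)
  exists v => //; rewrite subrr (leq_ltn_trans (dist_hamming 0)) //.
  rewrite (_ : hamming_dist 0 0 = 0%N) ?min_dist_gt0 //.
  by apply: eq_card0 => i; rewrite inE eqxx.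
have CD : (C <= C + <[v]>)%VS := addvSl _ _.
have D0 : (C + <[v]>)%VS != 0%VS.
  by apply: contraNneq C0 => D0; move: CD; rewrite D0 subv0.
have dimD : \dim (C + <[v]>) = (\dim C + 1)%N.
  rewrite dimv_disjoint_sum ?dim_vline.
    by case: eqP vC => // ->; rewrite mem0v.
  apply/eqP; rewrite -subv0; apply/subvP=> y; rewrite memv_cap memv0.
  case/andP=> yC /vlineP[a ya]; apply: contraNT vC => y0.
  have a0 : a != 0 by apply: contraNneq y0 => a0; rewrite ya a0 scale0r.
  by rewrite -(scalerK a0 v) -ya rpredZ.
(* The enlarged code has one more dimension, so by maximality its minimum distance strictly drops. A
   lightest word [y = c + a *: v] must have [a != 0], and dividing by [a] puts [v] near a
   codeword. *)
have := maxC (C + <[v]>)%VS; rewrite CD dimD eqxx /= => neq.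
have lt_d : (min_dist dist (C + <[v]>) < min_dist dist C)%N.
  by rewrite ltn_neqAle neq min_dist_antimono.
have [y yD [y0 dy]] := min_dist_attained D0.
case/memv_addP: yD => c cC [_ /vlineP[a ->] ye].
have a0 : a != 0.
  apply: contraTneq lt_d => a0; rewrite -leqNgt -dy min_dist_le //.
  by rewrite ye a0 scale0r addr0.
exists (- (a^-1 *: c)); first by rewrite rpredN rpredZ.
apply: leq_ltn_trans lt_d; rewrite -dy.
suff -> : v - - (a^-1 *: c) = a^-1 *: y by [].
by rewrite ye scalerDr scalerK // opprK addrC.
Qed.

Lemma maximal_card (C : {vspace 'rV[K]_n}) : is_maximal dist C ->
  (#|K| ^ n <= #|K| ^ \dim C * #|[set x | (dist x 0 < min_dist dist C)%N]|)%N.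
Proof.
move=> maxC; set B := [set x | _].
pose g (p : 'rV[K]_n * 'rV[K]_n) := p.1 + p.2.
have sub : [set: 'rV[K]_n] \subset g @: setX [set x | x \in C] B.
  apply/subsetP=> v _; have [c cC dv] := maximal_covering v maxC.
  by apply/imsetP; exists (c, v - c); rewrite ?inE ?cC ?dv // /g /= addrC subrK.
have := leq_trans (subset_leq_card sub) (leq_imset_card _ _).
by rewrite cardsT card_mx mul1n cardsX cardsE card_vspace.
Qed.

Hypothesis T_gt0 : (0 < #|T|)%N.
Hypothesis K_large : (#|T| ^ (n * n) < #|K|)%N.

(** The forward direction is the covering count; the converse is the Singleton bound applied to a
    code of one more dimension. The zero code fails both sides. *)
Lemma maximal_iff_singleton_equality (C : {vspace 'rV[K]_n}) :
  is_maximal dist C =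
    (1 <= \dim C)%N && (min_dist dist C == (n - \dim C + 1)%N).
Proof.
have [C0|C0] := boolP (C == 0%VS).
  by rewrite /is_maximal C0 (eqP C0) dimv0.
have dC : (0 < \dim C)%N by rewrite lt0n dimv_eq0.
rewrite dC /=; apply/idP/eqP => [maxC | eC]; last first.
  rewrite /is_maximal C0; apply/existsPn => D; apply/negP.
  case/and3P=> CD /eqP dD /eqP eD.
  have D0 : D != 0%VS by rewrite -dimv_eq0 dD addn1.
  have := singleton_bound D0; have := dim_rV D.
  (* Subtraction is truncated: [n - (k + 1) + 1 = n - k] requires [k < n], which [dim_rV D]
     provides. *)
  rewrite eD eC dD addn1 => lt_n; rewrite addn1 (_ : _ + 1 = n - \dim C)%N.
    by rewrite ltnn.
  by rewrite addn1 subnSK.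
apply/eqP; rewrite eqn_leq singleton_bound //= leqNgt addn1 ltnS.
apply/negP => le_d.
have := min_dist_gt0 C0.
case: (min_dist dist C) le_d (maximal_card maxC) => // r lt_r le_K _.
have rn : (r <= n)%N by rewrite (leq_trans (ltnW lt_r)) ?leq_subr.
have K_gt0 : (0 < #|K|)%N by apply: leq_ltn_trans K_large.
(* With [k = \dim C] and minimum distance [r + 1], the chain is |K|^n <= |K|^k |B(r)| <= |K|^(k+r)
   |T|^(rn) < |K|^(k+r+1) <= |K|^n, the last step because [r < n - k]. *)
have : (#|K| ^ n < #|K| ^ n)%N; last by rewrite ltnn.
apply: leq_ltn_trans (_ : _ <= #|K| ^ (\dim C + r) * #|T| ^ (r * n))%N _.
  apply: leq_trans le_K _; rewrite expnD -mulnA leq_mul2l.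
  by apply/orP; right; apply: card_ball.
apply: leq_trans (_ : #|K| ^ (\dim C + r) * #|K| <= _)%N; last first.
  rewrite -expnSr leq_pexp2l //.
  by move: lt_r; rewrite ltn_subRL.
rewrite ltn_pmul2l ?expn_gt0 ?K_gt0 //.
by apply: leq_ltn_trans K_large; rewrite leq_pexp2l // leq_mul2r rn orbT.
Qed.

(** Makes the family of maximal codes nonempty, so that the ratio below does not have denominator
    0. *)
Lemma maximal_fullv : (0 < n)%N -> is_maximal dist fullv.
Proof.
move=> n0; rewrite /is_maximal -dimv_eq0 dimvf /dim /= mul1n -lt0n n0.
apply/existsPn => D; apply/negP => /and3P[_ /eqP dD _].
by have := dim_rV D; rewrite dD addn1 ltnn.
Qed.

(** The predicate [P] is left abstract so that both [is_MDS] and [is_MRD] can be substituted for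
    it. *)
Lemma maximal_singleton_ratio (P : pred {vspace 'rV[K]_n}) : (0 < n)%N ->
  (forall C, P C = (1 <= \dim C)%N &&
     (min_dist dist C == (n - \dim C + 1)%N)) ->
  (forall C, is_maximal dist C -> P C) /\
  #|[set C | P C]|%:R / #|[set C | is_maximal dist C]|%:R = 1 :> rat.
Proof.
move=> n0 PE; have eqP C : P C = is_maximal dist C.
  by rewrite PE maximal_iff_singleton_equality.
split=> [C|]; first by rewrite eqP.
have -> : [set C | P C] = [set C | is_maximal dist C].
  by apply/setP=> C; rewrite !inE eqP.
rewrite divff // Num.Theory.pnatr_eq0 -lt0n; apply/card_gt0P; exists fullv.
by rewrite inE maximal_fullv.
Qed.

End TranslationInvariantDistance.

(** * The Hamming metric *)

Lemma hamming_distB (K : finFieldType) n (x y : 'rV[K]_n) :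
  hamming_dist x y = hamming_dist (x - y) 0.
Proof. by apply: eq_card => i; rewrite !inE !mxE subr_eq0. Qed.

Lemma hamming_dist_gt0 (K : finFieldType) n (x : 'rV[K]_n) :
  x != 0 -> (0 < hamming_dist x 0)%N.
Proof.
move=> /rV0Pn[i xi]; apply/card_gt0P; exists i.
by rewrite inE mxE.
Qed.

Lemma hamming_distZ (K : finFieldType) n a (x : 'rV[K]_n) :
  (hamming_dist (a *: x) 0 <= hamming_dist x 0)%N.
Proof.
apply: subset_leq_card; apply/subsetP=> i; rewrite !inE !mxE.
by apply: contraNneq => ->; rewrite mulr0.
Qed.

(** [A] lists the nonzero entries of [x], padded by zeros to length [r]. Column [i] of [M] is the
    unit vector at the position of [i] in the support, or zero off the support. *)
Lemma hamming_dist_factor (K : finFieldType) n r (x : 'rV[K]_n) :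
  (hamming_dist x 0 <= r)%N ->
  exists A : 'rV[K]_r, exists M : 'M[bool]_(r, n),
    x = A *m map_mx (fun b : bool => b%:R) M.
Proof.
rewrite /hamming_dist; set S := [set i | _] => Sr.
exists (\row_j nth 0 [seq x 0 i | i <- enum S] j).
exists (\matrix_(j, i) ((i \in S) && (index i (enum S) == j))).
apply/rowP=> i; rewrite mxE.
have [iS|/negbTE iS] := boolP (i \in S); last first.
  rewrite big1 => [|j _]; last by rewrite !mxE iS mulr0.
  by move/negbT: iS; rewrite inE mxE negbK => /eqP.
have idx : (index i (enum S) < #|S|)%N by rewrite cardE index_mem mem_enum.
rewrite (bigD1 (Ordinal (leq_trans idx Sr))) //= big1 => [|j ji].
  rewrite !mxE iS eqxx mulr1 addr0 (nth_map i) -?cardE //.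
  by rewrite nth_index // mem_enum.
rewrite !mxE iS /= [_ == _ :> nat]eq_sym.
by rewrite (negbTE ji : (j == _ :> nat) = _) mulr0.
Qed.

(** * The rank metric *)

Section RankWeight.

Variables (F : fieldType) (L : fieldExtType F) (n : nat).
Implicit Type x : 'rV[L]_n.

Lemma rank_distB x y : rank_dist x y = rank_dist (x - y) 0.
Proof. by rewrite /rank_dist subr0. Qed.

Lemma mem_rank_span x i : x 0 i \in <<[seq x 0%R i | i <- enum 'I_n]>>%VS.
Proof. by apply/memv_span/map_f; rewrite mem_enum. Qed.

Lemma rank_dist_gt0 x : x != 0 -> (0 < rank_dist x 0)%N.
Proof.
move=> /rV0Pn[i xi]; rewrite /rank_dist subr0 lt0n dimv_eq0.
by apply: contraNneq xi => s0; rewrite -memv0 -s0 mem_rank_span.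
Qed.

Lemma rank_dist_support x : (rank_dist x 0 <= #|[set i | (x 0 i != 0)%R]|)%N.
Proof.
rewrite /rank_dist subr0; set S := [set i | _].
have -> : #|S| = size [seq x 0 i | i <- enum S] by rewrite size_map -cardE.
apply: leq_trans (dim_span _); apply/dimvS/span_subvP=> _ /mapP[i _ ->].
have [iS|] := boolP (i \in S); first by apply/memv_span/map_f; rewrite mem_enum.
by rewrite inE negbK => /eqP->; rewrite mem0v.
Qed.

(** Multiplication by [a] is [F]-linear and maps the span of the entries of [x] onto that of
    [a *: x], so the dimension cannot grow. *)
Lemma rank_distZ a x : (rank_dist (a *: x) 0 <= rank_dist x 0)%N.
Proof.
rewrite /rank_dist !subr0 /rank_weight.
have -> : [seq (a *: x) 0 i | i <- enum 'I_n] =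
    [seq amull a y | y <- [seq x 0 i | i <- enum 'I_n]].
  by rewrite -[RHS]map_comp; apply: eq_map => i /=; rewrite mxE lfunE.
by rewrite -limg_span -[leqRHS](limg_ker_dim (amull a)) leq_addl.
Qed.

(** [A] lists an [F]-basis of the span of the entries of [x], and column [i] of [M] holds the
    coordinates of entry [i] in it. *)
Lemma rank_dist_factor r x : (rank_dist x 0 <= r)%N ->
  exists A : 'rV[L]_r, exists M : 'M[F]_(r, n), x = A *m map_mx (in_alg L) M.
Proof.
rewrite /rank_dist subr0 /rank_weight; set U := <<_>>%VS => Ur.
(* Indices [j] from [\dim U] up to [r] get coordinate 0 and only pad the sum. *)
pose c j i := if insub j is Some k then coord (vbasis U) k (x 0 i) else 0.
exists (\row_j (vbasis U)`_j), (\matrix_(j, i) c (j : nat) i).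
apply/rowP=> i; rewrite mxE [LHS](coord_vbasis (mem_rank_span x i)).
pose G (j : nat) := (vbasis U)`_j * in_alg L (c j i).
rewrite [RHS](eq_bigr (fun j : 'I_r => G j)) => [|j _]; last by rewrite !mxE.
rewrite (eq_bigr (fun j : 'I_(\dim U) => G j)) => [|j _]; last first.
  by rewrite /G /c valK /= mulr_algr.
rewrite (big_ord_widen r G Ur) big_mkcond; apply: eq_bigr => j _.
by case: ifP => // jU; rewrite /G /c insubF // rmorph0 mulr0.
Qed.

End RankWeight.

Theorem proposition7p3 (n : nat) (hn : (2 <= n)%N) :
  (exists q0 : nat, forall q : nat, (q0 <= q)%N ->
     forall F : finFieldType, #|F| = q ->
       (forall C : {vspace 'rV[F]_n},
          is_maximal (@hamming_dist F n) C -> is_MDS C)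
       /\ #|[set C : {vspace 'rV[F]_n} | is_MDS C]|%:R
          / #|[set C : {vspace 'rV[F]_n} | is_maximal (@hamming_dist F n) C]|%:R
          = 1 :> rat)
  /\
  (forall q : nat, exists m0 : nat, forall m : nat, (n <= m)%N -> (m0 <= m)%N ->
     forall F : finFieldType, #|F| = q ->
     forall L : fieldExtType F, \dim {:L} = m ->
       (forall C : {vspace 'rV[finvect_type L]_n},
          is_maximal (@rank_dist F (finvect_type L) n) C -> is_MRD C)
       /\ #|[set C : {vspace 'rV[finvect_type L]_n} | is_MRD C]|%:R
          / #|[set C : {vspace 'rV[finvect_type L]_n}
                | is_maximal (@rank_dist F (finvect_type L) n) C]|%:R
          = 1 :> rat).
Proof.
have n0 : (0 < n)%N := ltnW hn.
split.
  (* This is [#|T| ^ (n * n)] plus one, for [T = bool]. *)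
  exists (2 ^ (n * n)).+1 => q q_large F Fq.
  apply: (@maximal_singleton_ratio F n (@hamming_dist F n) _ _ _ bool
            (fun b : bool => b%:R)) => //.
  - exact: hamming_distB.
  - exact: hamming_dist_gt0.
  - exact: hamming_distZ.
  - exact: hamming_dist_factor.
  - by rewrite card_bool.
  - by rewrite card_bool Fq.
(* Here [T = F] and |K| = |F|^m, so [m > n * n] suffices because |F| > 1; the threshold is uniform
   in [q]. *)
move=> q; exists (n * n).+1 => m _ m_large F Fq L Lm.
have F_gt1 : (1 < #|F|)%N := finNzRing_gt1 F.
apply: (@maximal_singleton_ratio (finvect_type L) n
          (@rank_dist F (finvect_type L) n) _ _ _ F
          (in_alg (finvect_type L))) => //.
- exact: rank_distB.
- exact: rank_dist_gt0.
- move=> x; apply: leq_trans (rank_dist_support x) (subset_leq_card _).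
  by apply/subsetP=> i; rewrite !inE mxE.
- exact: rank_distZ.
- exact: rank_dist_factor.
- exact: ltnW.
- have -> : #|finvect_type L| =
      #|({: finvect_type L} : {vspace finvect_type L})%VS|.
    by apply: eq_card => v; rewrite memvf.
  by rewrite card_vspace Lm ltn_exp2l.
Qed.
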